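(* Let $n\ge 1$ be an integer, let $q$ be a prime power, let $\mathcal{C}\subseteq \mathrm{U}(n,\mathbb{F}_q)$ be a linear flag-rank-metric code with minimum distance $\delta=7$, and let $\alpha$ be its codimension. Then $\mathcal{C}$ is perfect if and only if $n\ge 3$ satisfies \[ \begin{aligned} &(q-1)^3n^3+3(q-1)^2(2q^2-q+2)n^2\\ &\quad+(q-1)(6q^4-18q^3+26q^2-7q+11)n\\ &\quad+6\bigl(-2q^5+4q^4-5q^3+3q^2+1-q^\alpha\bigr)=0. \end{aligned} \] Moreover, necessarily $\alpha\ge 10$.
   Context: $\mathbb{F}_q$ is the finite field with $q$ elements. $\mathrm{U}(n,\mathbb{F}_q)$ is the $\mathbb{F}_q$-vector space of $n\times n$ upper triangular matrices over $\mathbb{F}_q$; it has dimension $\frac{n(n+1)}{2}$. For $M\in \mathrm{U}(n,\mathbb{F}_q)$ and $1\le i\le n$, $M_{[i]}$ is the $i\times(n-i+1)$ submatrix of $M$ obtained by deleting the first $i-1$ columns and the last $n-i$ rows (i.e. rows $1,\dots,i$ and columns $i,\dots,n$). The flag-rank weight of $M$ is $\mathrm{fr}(M)=\sum_{i=1}^{n}\mathrm{rk}(M_{[i]})$; the flag-rank distance is $\mathrm{d}_{\mathrm{fr}}(A,B)=\mathrm{fr}(A-B)$. A linear flag-rank-metric code is an $\mathbb{F}_q$-subspace $\mathcal{C}$ of $\mathrm{U}(n,\mathbb{F}_q)$; its minimum (flag-rank) distance, defined when $\mathcal{C}\neq\{\boldsymbol{0}\}$, is $\delta=\min\{\mathrm{fr}(M):M\in\mathcal{C}\setminus\{\boldsymbol{0}\}\}$.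 Its codimension is $\frac{n(n+1)}{2}-\dim_{\mathbb{F}_q}(\mathcal{C})$. Let $b_q(n,t)=|\{A\in \mathrm{U}(n,\mathbb{F}_q):\mathrm{fr}(A)\le t\}|$. A code $\mathcal{C}$ with minimum distance $\delta$ is perfect if $|\mathcal{C}|\,b_q(n,t)=q^{\frac{n(n+1)}{2}}$, where $t=\left\lfloor\frac{\delta-1}{2}\right\rfloor$. *)

(* Defs.v *)
From HB Require Import structures.
From mathcomp Require Import all_boot all_order all_algebra.

Set Implicit Arguments.
Unset Strict Implicit.
Unset Printing Implicit Defensive.

Import Order.TTheory GRing.Theory Num.Theory.
Local Open Scope ring_scope.

(* [is_trig_mx] is lower triangularity, hence the transpose. *)
Definition upper_mx (F : finFieldType) (n : nat) : {set 'M[F]_n} :=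
  [set M : 'M[F]_n | is_trig_mx M^T].

Lemma corner_col_subproof (n k : nat) (j : 'I_(n - k)) : (k + j < n)%N.
Proof. by rewrite -ltn_subRL. Qed.

Definition corner_col (n k : nat) (j : 'I_(n - k)) : 'I_n :=
  Ordinal (corner_col_subproof j).

(* Indices start at 0: [corner M k] is M_[k+1], made of the rows 0, ..., k and
   the columns k, ..., n - 1 of M. *)
Definition corner (F : finFieldType) (n : nat) (M : 'M[F]_n) (k : 'I_n) :
    'M[F]_(k.+1, n - k) :=
  mxsub (widen_ord (ltn_ord k)) (@corner_col n k) M.

Definition flag_rank (F : finFieldType) (n : nat) (M : 'M[F]_n) : nat :=
  (\sum_(k < n) \rank (corner M k))%N.

Definition flag_rank_code (F : finFieldType) (n : nat)
    (C : {vspace 'M[F]_n}) : Prop :=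
  {subset C <= upper_mx F n}.

(* For C <> 0, [vpick C] is a nonzero element of C, so this is the minimum of
   the weights of the nonzero codewords. For C = 0 the value is
   [flag_rank 0 = 0], which is not the minimum distance of any nonzero code. *)
Definition min_distance (F : finFieldType) (n : nat)
    (C : {vspace 'M[F]_n}) : nat :=
  flag_rank [arg min_(M < vpick C | (M \in C) && (M != 0)) flag_rank M].

(* For a code, \dim C <= n(n+1)/2, so the natural subtraction is exact. *)
Definition codimension (F : finFieldType) (n : nat)
    (C : {vspace 'M[F]_n}) : nat :=
  ((n * n.+1) %/ 2 - \dim C)%N.

Definition ball_size (F : finFieldType) (n t : nat) : nat :=
  #|[set A in upper_mx F n | (flag_rank A <= t)%N]|.

Definition perfect (F : finFieldType) (n : nat)
    (C : {vspace 'M[F]_n}) : Prop :=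
  (#|[set M : 'M[F]_n | M \in C]| * ball_size F n ((min_distance C - 1) %/ 2)
   = #|F| ^ ((n * n.+1) %/ 2))%N.

(* Main.v *)
(* Let a_n(w) be the number of upper triangular n x n matrices of flag-rank w,
   and y_n(w) the number of those whose first row is nonzero. Deleting a zero
   first row gives a_(n+1)(w) = a_n(w) + y_(n+1)(w). Let w <= 2, let the first
   row (a, r) of a matrix of weight w + 1 be nonzero, and let v be the second
   row from the diagonal on. Then r and v are linearly dependent, as otherwise
   the first three corners already contribute 1 + 2 + 1 > w + 1. If r and v are
   not both 0, merge the first two rows into r (if r <> 0, so that v = l r, with
   l and a free) or into v (if r = 0, so that a <> 0); if r = v = 0, delete them.
   Either way the weight drops by exactly 1, whence
     y_(n+2)(w + 1) = (q - 1) a_n(w) + (q^2 + q - 1) y_(n+1)(w).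
   This recursion determines the size of the ball of radius 3, and C is perfect
   exactly when that size is q^alpha. Finally, an upper triangular matrix whose
   nonzero columns are among the first four has weight at most
   1 + 2 + 2 + 1 = 6, so C meets the space of these matrices trivially; hence
   n >= 4, the space has dimension 10, and alpha >= 10. *)

Require Import Defs.
From HB Require Import structures.
From mathcomp Require Import all_boot all_order all_algebra all_field.
From mathcomp Require Import ring zify.

Set Implicit Arguments.
Unset Strict Implicit.
Unset Printing Implicit Defensive.

Import Order.TTheory GRing.Theory Num.Theory.
Local Open Scope ring_scope.

(** * Flag-rank of a matrix with rows stacked on top *)

Definition add_row (F : finFieldType) n (v : 'rV[F]_(1 + n)) (M : 'M[F]_n) :
    'M[F]_n.+1 :=
  col_mx v (row_mx 0 M).

(* The part of the flag-rank contributed by the corners ending in a row of M,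
   when the rows of X are stacked on top of M. *)
Definition flag_rank_over (F : finFieldType) m n (X : 'M[F]_(m, n))
    (M : 'M[F]_n) : nat :=
  (\sum_(k < n) \rank (col_mx (colsub (@corner_col n k) X) (corner M k)))%N.

Lemma Posz_expn (m k : nat) : (m ^ k)%:Z = m%:Z ^+ k.
Proof. by rewrite -!natz natrX. Qed.

Section FlagRank.
Variable F : finFieldType.

(** Selecting columns is multiplication on the right by a fixed matrix, so only the row space of X
    matters. This is what allows dependent rows to be merged. *)
Lemma flag_rank_over_eqmx m1 m2 n (X : 'M[F]_(m1, n)) (Y : 'M[F]_(m2, n)) M :
  (X :=: Y)%MS -> flag_rank_over X M = flag_rank_over Y M.
Proof.
move=> eqXY; apply: eq_bigr => k _; rewrite -!addsmxE.
have eqk : (colsub (@corner_col n k) X :=: colsub (@corner_col n k) Y)%MS.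
  by rewrite -[X]mulmx1 -[Y]mulmx1 -!mulmx_colsub; apply: eqmxMr.
by rewrite (adds_eqmx eqk (eqmx_refl _)).
Qed.

Lemma flag_rank_over0 m n (M : 'M[F]_n) :
  flag_rank_over (0 : 'M_(m, n)) M = flag_rank M.
Proof.
apply: eq_bigr => k _.
have -> : colsub (@corner_col n k) 0 = 0 :> 'M[F]_(m, n - k).
  by apply/matrixP => i j; rewrite !mxE.
by rewrite rank_col_0mx.
Qed.

(** The corner ending in v still has all the columns, which gives the first summand. For the later
    corners v joins X and the first column is dropped. *)
Lemma flag_rank_over_add_row m n (X : 'M[F]_(m, 1 + n)) v (M : 'M_n) :
  flag_rank_over X (add_row v M) =
  (\rank (col_mx X v) + flag_rank_over (rsubmx (col_mx X v)) M)%N.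
Proof.
rewrite /flag_rank_over big_ord_recl; congr addn.
  apply: (f_equal (fun A : 'M[F]_(m + 1, n.+1) => \rank A)).
  apply/matrixP => i j; rewrite !mxE.
  case: splitP => i' _; rewrite !mxE; first by congr (X _ _); apply: val_inj.
  case: splitP => k /=; last by have := ltn_ord i'; rewrite /=; lia.
  by move=> _; rewrite [k]ord1 [i']ord1; congr (v _ _); apply: val_inj.
apply: eq_bigr => k _.
pose g := @corner_col n k.
have -> : corner (add_row v M) (lift ord0 k) =
    col_mx (colsub g (rsubmx v)) (corner M k) :> 'M[F]_(1 + k.+1, n - k).
  apply/matrixP => i j; rewrite !mxE.
  have -> : @corner_col n.+1 (lift ord0 k) j = rshift 1 (g j) :> 'I_(1 + n).
    exact: val_inj.
  case: splitP => i' /= def_i; case: splitP => i0 /= def_i0.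
  - by rewrite !mxE [i']ord1; congr (v _ _); apply: val_inj; rewrite [i0]ord1.
  - by have := ltn_ord i'; rewrite -def_i def_i0.
  - by have := ltn_ord i0; rewrite -def_i0 def_i.
  - rewrite row_mxEr !mxE; congr (M _ _); apply: val_inj.
    exact: succn_inj (etrans (esym def_i) def_i0).
have -> : colsub (@corner_col n.+1 (lift ord0 k)) X = colsub g (rsubmx X)
    :> 'M[F]_(m, n - k).
  by apply/matrixP => i j; rewrite !mxE; congr (X _ _); apply: val_inj.
have -> : colsub g (rsubmx (col_mx X v)) =
    col_mx (colsub g (rsubmx X)) (colsub g (rsubmx v)).
  apply/matrixP => i j; rewrite !mxE.
  by case: splitP => i' _; rewrite !mxE.
set X' := colsub g _; set v' := colsub g _; set c := corner M k.
(* Sums of row spaces reassociate the three blocks without a cast between heights. *)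
transitivity (\rank (X' + (v' + c))%MS).
  have e : (X' + (v' + c) :=: col_mx X' (col_mx v' c))%MS.
    apply: eqmx_trans (addsmxE _ _).
    exact: adds_eqmx (eqmx_refl _) (addsmxE _ _).
  by rewrite e.
rewrite addsmxA.
have e : (X' + v' + c :=: col_mx (col_mx X' v') c)%MS.
  apply: eqmx_trans (addsmxE _ _).
  exact: adds_eqmx (addsmxE _ _) (eqmx_refl _).
by rewrite e.
Qed.

Lemma rsubmx_eqmx m1 m2 n1 n2 (X : 'M[F]_(m1, n1 + n2))
    (Y : 'M[F]_(m2, n1 + n2)) :
  (X :=: Y)%MS -> (rsubmx X :=: rsubmx Y)%MS.
Proof.
move=> eqXY; rewrite !rsubmxEsub -[X]mulmx1 -[Y]mulmx1 -!mulmx_colsub.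
exact: eqmxMr.
Qed.

Lemma col_0mx_eqmx m1 m2 n (Y : 'M[F]_(m2, n)) :
  (col_mx (0 : 'M_(m1, n)) Y :=: Y)%MS.
Proof. exact: eqmx_trans (eqmx_sym (addsmxE _ _)) (adds0mx _ _). Qed.

Lemma flag_rank_add_row n v (M : 'M[F]_n) :
  flag_rank (add_row v M) = ((v != 0%R) + flag_rank_over (rsubmx v) M)%N.
Proof.
rewrite -(flag_rank_over0 1) flag_rank_over_add_row rank_col_0mx rank_rV.
congr addn; apply: flag_rank_over_eqmx; apply: rsubmx_eqmx.
exact: col_0mx_eqmx.
Qed.

Lemma flag_rank_add_row0 n (M : 'M[F]_n) : flag_rank (add_row 0 M) = flag_rank M.
Proof.
rewrite flag_rank_add_row eqxx /= -(flag_rank_over0 1); congr flag_rank_over.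
by apply/matrixP => i j; rewrite !mxE.
Qed.

Lemma flag_rank_over_sub n (r v : 'rV[F]_(1 + n)) (M : 'M_n) :
  r != 0 -> (v <= r)%MS ->
  flag_rank_over r (add_row v M) = flag_rank (add_row r M).
Proof.
move=> r0 vr; rewrite flag_rank_over_add_row flag_rank_add_row.
have e : (col_mx r v :=: r)%MS.
  exact: eqmx_trans (eqmx_sym (addsmxE _ _)) (addsmx_idPl vr).
by rewrite e rank_rV r0 (flag_rank_over_eqmx _ (rsubmx_eqmx e)).
Qed.

(** The corner ending in v contributes 2 and the next one at least 1, because a matrix of rank 2
    cannot vanish outside its first column. *)
Lemma flag_rank_over_gt2 n (r v : 'rV[F]_(1 + n)) (M : 'M_n) :
  r != 0 -> ~~ (v <= r)%MS -> (2 < flag_rank_over r (add_row v M))%N.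
Proof.
move=> r0 vr; rewrite flag_rank_over_add_row.
have rk2 : (1 < \rank (col_mx r v))%N.
  rewrite -addsmxE.
  have := mxrankS (addsmxSl r v); rewrite leq_eqVlt => /orP[e|]; last first.
    by rewrite [\rank r]rank_rV r0.
  case/negP: vr; apply: submx_trans (addsmxSr r v) _.
  by rewrite -(geq_leqif (mxrank_leqif_sup (addsmxSl r v))) (eqP e).
rewrite -[3%N]/(2 + 1)%N leq_add //.
have X0 : rsubmx (col_mx r v) != 0.
  apply: contraTneq rk2 => X0; rewrite -leqNgt.
  rewrite -[col_mx r v]hsubmxK X0.
  rewrite -[row_mx _ _]trmxK mxrank_tr tr_row_mx trmx0 rank_col_mx0.
  exact: rank_leq_row.
(* For n = 0 there is no next corner, but then [X0] speaks of a matrix without columns and is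
   contradictory. *)
case: n r v M r0 vr rk2 X0 => [|n] r v M r0 vr rk2 X0.
  by case/eqP: X0; apply/matrixP => i [].
rewrite /flag_rank_over big_ord_recl addn_gt0; apply/orP; left.
rewrite lt0n mxrank_eq0; apply: contra X0 => /eqP e.
have := congr1 usubmx e; rewrite col_mxKu linear0.
move=> /matrixP {}e; apply/eqP/matrixP => i j.
have := e i j; rewrite !mxE.
by case: splitP => k _ <-; congr (_ _ _); apply: val_inj.
Qed.

(** * Upper triangular matrices built row by row *)

Lemma upper_mxP n (M : 'M[F]_n) :
  reflect (forall i j : 'I_n, (j < i)%N -> M i j = 0) (M \in upper_mx F n).
Proof.
rewrite inE; apply: (iffP is_trig_mxP) => H i j ij.
  by rewrite -(H j i ij) mxE.
by rewrite mxE H.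
Qed.

Lemma add_row_lift n v (M : 'M[F]_n) (i j : 'I_n) :
  add_row v M (lift ord0 i) (lift ord0 j) = M i j.
Proof.
rewrite -[RHS](row_mxEr (0 : 'cV_n)) -[RHS](col_mxEd v).
by congr (add_row v M _ _); apply: val_inj.
Qed.

Lemma add_row_lift0 n v (M : 'M[F]_n) (i : 'I_n) :
  add_row v M (lift ord0 i) ord0 = 0.
Proof.
have <- : (0 : 'cV[F]_n) i ord0 = 0 by rewrite mxE.
rewrite -(row_mxEl 0 M) -[RHS](col_mxEd v).
by congr (add_row v M _ _); apply: val_inj.
Qed.

Lemma add_row_upper n v (M : 'M[F]_n) :
  (add_row v M \in upper_mx F n.+1) = (M \in upper_mx F n).
Proof.
apply/upper_mxP/upper_mxP => H i j ij.
  by rewrite -(add_row_lift v) H.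
case: (unliftP ord0 i) ij => [i' ->|-> //] ij.
case: (unliftP ord0 j) ij => [j' ->|->] ij; last exact: add_row_lift0.
by rewrite add_row_lift H.
Qed.

(** Triangularity forces the first column to vanish below the diagonal, so splitting off the first
    row is a bijection. *)
Lemma sum_upper_mx_recl n (f : 'M[F]_n.+1 -> nat) :
  (\sum_(M in upper_mx F n.+1) f M =
   \sum_(M in upper_mx F n) \sum_(v : 'rV[F]_(1 + n)) f (add_row v M))%N.
Proof.
rewrite pair_big /=.
pose h (p : 'M[F]_n * 'rV[F]_(1 + n)) := add_row p.2 p.1.
pose h' (M : 'M[F]_n.+1) := (drsubmx (M : 'M_(1 + n)), usubmx (M : 'M_(1 + n))).
rewrite (reindex_onto h h') => [|M /upper_mxP M_up]; last first.
  rewrite /h /h' /add_row /=.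
  transitivity (col_mx (usubmx (M : 'M_(1 + n)))
    (dsubmx (M : 'M_(1 + n))) : 'M_n.+1);
    last exact: (@vsubmxK _ 1 n).
  apply: (f_equal (col_mx (usubmx (M : 'M_(1 + n))))).
  rewrite -[RHS](@hsubmxK _ _ 1 n).
  apply: (f_equal (fun A => row_mx A (drsubmx (M : 'M_(1 + n))))).
  by apply/matrixP => i j; rewrite !mxE M_up //= ord1.
apply: eq_bigl => -[M v]; rewrite /h /h' add_row_upper andbT /=.
by rewrite /add_row col_mxKu /drsubmx col_mxKd row_mxKr eqxx andbT.
Qed.

Lemma sum_rV_recl n (f : 'rV[F]_(1 + n) -> nat) :
  (\sum_v f v = \sum_(r : 'rV_n) \sum_(a : F) f (row_mx a%:M r))%N.
Proof.
rewrite pair_big /=.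
rewrite (reindex (fun p : 'rV[F]_n * F => row_mx p.2%:M p.1 : 'rV_(1 + n))) //.
exists (fun v => (rsubmx v, v 0 (lshift n 0))) => [[r a]|v] _ /=.
  by rewrite row_mxKr row_mxEl mxE eqxx.
by rewrite -[RHS]hsubmxK; congr row_mx; rewrite [RHS]mx11_scalar mxE.
Qed.

(** * The numbers a_n(w) and y_(n+1)(w) and their recursion *)

Definition weight_count n w : nat :=
  (\sum_(M in upper_mx F n) (flag_rank M == w))%N.

(* This counts matrices of size n + 1. *)
Definition weight_count_row n w : nat :=
  (\sum_(M in upper_mx F n) \sum_(v : 'rV[F]_(1 + n))
     ((v != 0%R) && (flag_rank (add_row v M) == w)))%N.

Lemma sum_rV_neq0 n (P : pred 'rV[F]_n) :
  (\sum_v P v = P 0%R + \sum_v ((v != 0%R) && P v))%N.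
Proof.
rewrite (bigD1 0) //=; congr addn.
by rewrite big_mkcond; apply: eq_bigr => v _; case: (v != 0).
Qed.

Lemma weight_countS n w :
  (weight_count n.+1 w = weight_count n w + weight_count_row n w)%N.
Proof.
rewrite /weight_count sum_upper_mx_recl -big_split /=.
apply: eq_bigr => M _; rewrite (sum_rV_neq0 (fun v => _ == w)).
by rewrite flag_rank_add_row0.
Qed.

Lemma card_row_submx n (r : 'rV[F]_n) :
  r != 0 -> (\sum_(v : 'rV_n | (v <= r)%MS) 1 = #|F|)%N.
Proof.
move=> r0; rewrite sum1_card -[RHS](card_imset _ (f := fun a : F => a *: r)).
  apply: eq_card => v; apply/sub_rVP/imsetP => [[a ->]|[a _ ->]]; exists a => //.
move=> a b /eqP; rewrite -subr_eq0 -scalerBl scaler_eq0 (negPf r0) orbF.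
by rewrite subr_eq0 => /eqP.
Qed.

(** As w <= 2, only the q multiples of r can occur as v, and each of them merges with r. *)
Lemma count_row_extensions n w (r : 'rV[F]_(1 + n)) (M : 'M_n) :
  r != 0 -> (w <= 2)%N ->
  (\sum_(v : 'rV[F]_(1 + n)) (flag_rank_over r (add_row v M) == w) =
   #|F| * (flag_rank (add_row r M) == w))%N.
Proof.
move=> r0 w2; rewrite -(card_row_submx r0) big_distrl /=.
rewrite [RHS]big_mkcond /=; apply: eq_bigr => v _.
case: ifP => vr; first by rewrite flag_rank_over_sub // mul1n.
have := flag_rank_over_gt2 M r0 (negbT vr).
by case: eqP => // ->; rewrite ltnNge w2.
Qed.

(** Write v = (a, r). If r = 0, there are q - 1 values of a and v' is arbitrary; v' = 0 yields the
    term in M alone. If r <> 0, then a and the ratio of v' to r are free, which gives q^2. Hence the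
    coefficient q^2 + q - 1. *)
Lemma count_two_rows n w (M : 'M[F]_n) : (w <= 2)%N ->
  (\sum_(v' : 'rV[F]_(1 + n)) \sum_(v : 'rV[F]_(1 + (1 + n)))
     ((v != 0%R) && (flag_rank (add_row v (add_row v' M)) == w.+1)) =
   (#|F| - 1) * (flag_rank M == w) +
   (#|F| ^ 2 + #|F| - 1) * \sum_(v' : 'rV[F]_(1 + n))
      ((v' != 0%R) && (flag_rank (add_row v' M) == w)))%N.
Proof.
move=> w2.
have neq0_row_mx a (r : 'rV[F]_(1 + n)) :
    (row_mx a%:M r != 0) = (a != 0) || (r != 0).
  rewrite -[0 in LHS](row_mx0 _ 1 1) -negb_and; congr negb.
  apply/eqP/andP => [/eq_row_mx[/(congr1 (fun A : 'M_1 => A 0 0)) a0 ->]|].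
    by move: a0; rewrite !mxE eqxx mulr1n => ->.
  case=> /eqP-> /eqP->; congr row_mx; exact: raddf0.
have card_neq0 : (\sum_(a : F) (a != 0%R) = #|F| - 1)%N.
  rewrite subn1 -(cardC1 (0 : F)) -sum1_card [RHS]big_mkcond /=.
  by apply: eq_bigr => a _; rewrite inE; case: eqP.
(* Apart from the condition v <> 0, nothing depends on a: the corners after the first see only r. *)
transitivity (\sum_(r : 'rV[F]_(1 + n)) \sum_(v' : 'rV[F]_(1 + n))
    (if r == 0%R then #|F| - 1 else #|F|) *
    (flag_rank_over r (add_row v' M) == w))%N.
  rewrite [RHS]exchange_big /=; apply: eq_bigr => v' _.
  rewrite sum_rV_recl; apply: eq_bigr => r _.
  transitivity (\sum_(a : F) ((a != 0%R) || (r != 0%R)) *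
      (flag_rank_over r (add_row v' M) == w))%N.
    apply: eq_bigr => a _; rewrite flag_rank_add_row neq0_row_mx row_mxKr.
    by case: (_ || _); rewrite ?mul0n // mul1n.
  rewrite -big_distrl /=; congr muln; case: eqP => _ /=.
    by rewrite -card_neq0; apply: eq_bigr => a _; rewrite orbF.
  by rewrite -sum1_card; apply: eq_bigr => a _; rewrite orbT.
rewrite (bigD1 0%R) //= eqxx -big_distrr /=.
have -> : (\sum_(r : 'rV[F]_(1 + n) | r != 0%R) \sum_(v' : 'rV[F]_(1 + n))
    (if r == 0%R then #|F| - 1 else #|F|) *
    (flag_rank_over r (add_row v' M) == w) =
  #|F| * #|F| * \sum_(r : 'rV[F]_(1 + n))
    ((r != 0%R) && (flag_rank (add_row r M) == w)))%N.
  rewrite [RHS]big_distrr [LHS]big_mkcond /=; apply: eq_bigr => r _.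
  case: ifP => r0; last by rewrite muln0.
  by rewrite (negPf r0) -big_distrr /= count_row_extensions //= mulnA.
under eq_bigr do rewrite flag_rank_over0.
rewrite (sum_rV_neq0 (fun v => _ == w)) flag_rank_add_row0.
(* Positivity makes the truncated subtractions exact. *)
have : (0 < #|F|)%N by apply/card_gt0P; exists 0.
by case: #|F| => // q _; rewrite addnS !subn1 /= -mulnn; ring.
Qed.

Lemma weight_count_rowSS n w : (w <= 2)%N ->
  (weight_count_row n.+1 w.+1 = (#|F| - 1) * weight_count n w +
     (#|F| ^ 2 + #|F| - 1) * weight_count_row n w)%N.
Proof.
move=> w2; rewrite /weight_count_row sum_upper_mx_recl !big_distrr -big_split.
by apply: eq_bigr => M _; rewrite count_two_rows.
Qed.

Lemma upper_mx_0 (M : 'M[F]_0) : M \in upper_mx F 0.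
Proof. by apply/upper_mxP => - []. Qed.

Lemma weight_count0n w : weight_count 0 w = (w == 0)%N.
Proof.
rewrite /weight_count (eq_bigl predT); last by move=> M; rewrite upper_mx_0.
rewrite (big_pred1 0) => [|M]; first by rewrite /flag_rank big_ord0 eq_sym.
by rewrite /= [M]flatmx0 eqxx.
Qed.

Lemma weight_count_row0n w :
  weight_count_row 0 w = ((#|F| - 1) * (w == 1%N))%N.
Proof.
rewrite /weight_count_row (eq_bigl predT); last by move=> M; rewrite upper_mx_0.
rewrite (big_pred1 0) => [|M]; last by rewrite /= [M]flatmx0 eqxx.
transitivity (\sum_(v : 'rV[F]_(1 + 0)) (v != 0%R) * (w == 1))%N.
  apply: eq_bigr => v _; rewrite flag_rank_add_row /flag_rank_over big_ord0.
  by case: (v != 0); rewrite // mul1n eq_sym.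
rewrite -big_distrl /=; congr muln; rewrite subn1.
have -> : #|F| = #|{: 'rV[F]_(1 + 0)}| by rewrite card_mx expn1.
rewrite -(cardC1 0) -sum1_card [RHS]big_mkcond /=.
by apply: eq_bigr => v _; rewrite inE; case: eqP.
Qed.

Lemma weight_count_row_n0 n : weight_count_row n 0 = 0%N.
Proof.
rewrite /weight_count_row; apply: big1 => M _; apply: big1 => v _.
by rewrite flag_rank_add_row; case: (v != 0).
Qed.

Lemma ball_sizeE n t :
  ball_size F n t = (\sum_(w < t.+1) weight_count n w)%N.
Proof.
rewrite /weight_count exchange_big /ball_size cardsE -sum1_card /=.
rewrite big_mkcondr /=; apply: eq_bigr => M _.
case: leqP => wM.
  rewrite (bigD1 (Ordinal (wM : (_ < t.+1)%N))) //= eqxx big1 // => i.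
  by rewrite -val_eqE /= eq_sym => /negPf->.
by rewrite big1 // => i _; case: eqP (ltn_ord i) wM => // ->;
  rewrite ltnS leqNgt => /negPf->.
Qed.

(** * The codimension bound from the first four columns *)

Lemma mxrank_leq_support m n r (A : 'M[F]_(m, n)) :
  (forall i (j : 'I_n), (r <= j)%N -> A i j = 0) -> (\rank A <= r)%N.
Proof.
move=> A0; have -> : A = A *m pid_mx r.
  apply/matrixP => i j; rewrite mxE (bigD1 j) //= big1 => [|l lj]; last first.
    by rewrite mxE (negPf (lj : l != j :> nat)) mulr0.
  rewrite mxE eqxx /= addr0; case: ltnP => rj; first by rewrite mulr1.
  by rewrite mulr0 A0.
(* The projection [pid_mx r] factors through a space of dimension r. *)
rewrite -(pid_mx_id F n n (leqnn r)) mulmxA.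
exact: leq_trans (mxrankM_maxl _ _) (rank_leq_col _).
Qed.

(** Corner k has k + 1 rows and at most 4 - k nonzero columns (none for k >= 4); the minima 1, 2, 2,
    1 add up to 6. *)
Lemma flag_rank_leq6 n (M : 'M[F]_n) :
  (forall i j : 'I_n, (4 <= j)%N -> M i j = 0) -> (flag_rank M <= 6)%N.
Proof.
move=> M0; apply: (@leq_trans (\sum_(k < n) minn k.+1 (4 - k))).
  apply: leq_sum => k _; rewrite leq_min rank_leq_row /=.
  by apply: mxrank_leq_support => i j kj; rewrite mxE M0 //= -leq_subLR.
case: n M M0 => [|[|[|[|n]]]] _ _;
  rewrite ?big_ord0 // !big_ord_recl /= ?big_ord0 //.
by rewrite big1.
Qed.

(** The 10 = 1 + 2 + 3 + 4 counts the positions on or above the diagonal in the first four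
    columns. *)
Lemma card_support_right n :
  (4 <= n)%N ->
  (#|[pred p : 'I_n * 'I_n | (p.1 <= p.2)%N && (4 <= p.2)%N]| + 10 =
   (n * n.+1) %/ 2)%N.
Proof.
move=> n4.
have -> : #|[pred p : 'I_n * 'I_n | (p.1 <= p.2)%N && (4 <= p.2)%N]| =
    (\sum_(j < n) (4 <= j) * j.+1)%N.
  rewrite -sum1_card big_mkcond /=.
  transitivity (\sum_(i < n) \sum_(j < n) (4 <= j) * (i < j.+1))%N.
    rewrite pair_big /=; apply: eq_bigr => p _; rewrite inE ltnS mulnC.
    by do 2!case: (_ <= _)%N.
  rewrite exchange_big /=; apply: eq_bigr => j _.
  rewrite -big_distrr /= -big_mkcond /=; congr muln.
  by rewrite -(big_ord_widen n (fun=> 1%N)) // sum1_card card_ord.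
case: n n4 => [|[|[|[|n]]]] // _.
(* The doubled identity keeps division out of the induction. *)
have : ((\sum_(j < n.+4) (4 <= j) * j.+1) * 2 + 20 = n.+4 * n.+4.+1)%N.
  elim: n => [|n IHn]; first by rewrite !big_ord_recl big_ord0.
  by rewrite big_ord_recr /= mul1n; move: IHn; set S := (\sum_ _ _)%N; nia.
lia.
Qed.

Lemma card_code n (C : {vspace 'M[F]_n}) :
  #|[set M : 'M[F]_n | M \in C]| = (#|F| ^ \dim C)%N.
Proof. by rewrite cardsE; apply: card_vspace. Qed.

Lemma min_distance_leq n (C : {vspace 'M[F]_n}) M :
  M \in C -> M != 0 -> (min_distance C <= flag_rank M)%N.
Proof.
move=> MC M0; rewrite /min_distance.
case: arg_minnP => [|N _]; last by apply; rewrite MC.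
(* The default value [vpick C] must be a nonzero codeword; it is one because C contains M <> 0. *)
rewrite memv_pick vpick0; apply: contraNneq M0 => C0.
by move: MC; rewrite C0 memv0.
Qed.

(** Keeping only the columns of index at least 4 is injective on C: two codewords with the same
    image differ by a matrix of weight at most 6. Comparing cardinalities bounds the dimension. *)
Lemma dim_flag_rank_code n (C : {vspace 'M[F]_n}) :
  flag_rank_code C -> (6 < min_distance C)%N ->
  (4 <= n)%N /\ (\dim C + 10 <= (n * n.+1) %/ 2)%N.
Proof.
move=> C_up C7.
have wt_gt6 M : M \in C -> M != 0 -> (6 < flag_rank M)%N.
  by move=> MC M0; apply: leq_trans C7 (min_distance_leq MC M0).
(* [min_distance C] is itself a weight, and with at most three columns every weight is at most 6. *)
have n4 : (4 <= n)%N.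
  rewrite ltnNge; apply: contraL C7 => n3; rewrite -leqNgt.
  apply: flag_rank_leq6 => i j j4; have := ltn_ord j; lia.
split=> //; rewrite -card_support_right // leq_add2r.
have F2 : (1 < #|F|)%N by apply/card_gt1P; exists 0, 1; rewrite // eq_sym oner_eq0.
set S := [pred p : 'I_n * 'I_n | _].
pose phi (M : 'M[F]_n) : {ffun 'I_n * 'I_n -> F} :=
  [ffun p : 'I_n * 'I_n => if (4 <= p.2)%N then M p.1 p.2 else 0].
rewrite -(leq_exp2l _ _ F2) -card_code -(card_pffun_on 0 S predT).
rewrite -(card_in_imset (f := phi)); last first.
  move=> M N; rewrite !inE => MC NC /ffunP eqMN; apply/eqP; rewrite -subr_eq0.
  apply/idPn => /(wt_gt6 _ (memvB MC NC)).
  rewrite ltnNge flag_rank_leq6 // => i j j4.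
  by have := eqMN (i, j); rewrite !ffunE /= j4 !mxE => ->; rewrite subrr.
apply: subset_leq_card; apply/subsetP => _ /imsetP[M MC ->].
apply/pffun_onP; split=> [|//]; apply/supportP => -[i j].
rewrite inE /= ffunE /= negb_and => /orP[|/negPf-> //]; rewrite -ltnNge => ji.
rewrite inE in MC; move/upper_mxP: (C_up _ MC) => -> //; exact: if_same.
Qed.

(** The radius is (7 - 1) / 2 = 3, and the factor q^(dim C) cancels. *)
Lemma perfectE n (C : {vspace 'M[F]_n}) :
  min_distance C = 7%N -> (\dim C <= (n * n.+1) %/ 2)%N ->
  perfect C <-> ball_size F n 3 = (#|F| ^ codimension C)%N.
Proof.
move=> C7 dimC; rewrite /perfect card_code C7 /codimension.
have F0 : (0 < #|F|)%N by apply/card_gt0P; exists 0.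
rewrite -{1}(subnKC dimC) expnD.
split=> [/eqP|->//]; rewrite eqn_pmul2l ?expn_gt0 ?F0 //; exact: eqP.
Qed.

(** * Closed formulas for the weights up to 3 and for the ball *)

Lemma weight_count_n0 n : weight_count n 0 = 1%N.
Proof.
by elim: n => [|n IHn];
  rewrite ?weight_count0n // weight_countS weight_count_row_n0 IHn.
Qed.

(** The two coefficients of the recursion [weight_count_rowSS]. *)
Let p := (#|F| - 1)%N.
Let s := (#|F| ^ 2 + #|F| - 1)%N.

Lemma weight_count_row1 n : weight_count_row n 1 = p.
Proof.
case: n => [|n]; first by rewrite weight_count_row0n muln1.
by rewrite weight_count_rowSS // weight_count_row_n0 weight_count_n0 muln1 muln0
  addn0.
Qed.

Lemma weight_count1 n : weight_count n 1 = (n * p)%N.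
Proof.
elim: n => [|n IHn]; first by rewrite weight_count0n.
by rewrite weight_countS weight_count_row1 IHn mulSn addnC.
Qed.

Lemma weight_count_row2 n : weight_count_row n.+1 2 = (p ^ 2 * n + s * p)%N.
Proof.
by rewrite weight_count_rowSS // weight_count_row1 weight_count1 -/p -/s; ring.
Qed.

(** Summing the row counts gives p^2 binom(n, 2) + n s p. Doubling clears the denominator, and over
    the integers n - 1 is not truncated at n = 0. *)
Lemma weight_count2 n :
  2 * (weight_count n.+1 2)%:Z =
  p%:Z ^+ 2 * n%:Z * (n%:Z - 1) + 2 * n%:Z * s%:Z * p%:Z.
Proof.
elim: n => [|n IHn].
  rewrite weight_countS weight_count0n weight_count_row0n /= muln0 addn0.
  by ring.
rewrite weight_countS weight_count_row2 PoszD mulrDr IHn.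
rewrite !PoszD !PoszM -[n.+1]addn1 PoszD; ring.
Qed.

Lemma weight_count_row3 n :
  2 * (weight_count_row n.+2 3)%:Z =
  p%:Z ^+ 3 * n%:Z * (n%:Z - 1) + 4 * n%:Z * s%:Z * p%:Z ^+ 2
  + 2 * s%:Z ^+ 2 * p%:Z.
Proof.
rewrite weight_count_rowSS // weight_count_row2 -/p -/s !(PoszD, PoszM).
have := weight_count2 n; set x := Posz (weight_count _ _) => e.
transitivity (p%:Z * (2 * x) + 2 * s%:Z * (p%:Z ^+ 2 * n%:Z + s%:Z * p%:Z)).
  by ring.
by rewrite e; ring.
Qed.

(** The count is p^3 binom(n, 3) + 2 binom(n, 2) s p^2 + n s^2 p, again by summation; the factor 6
    clears the denominators. *)
Lemma weight_count3 n :
  6 * (weight_count n.+2 3)%:Z =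
  p%:Z ^+ 3 * n%:Z * (n%:Z - 1) * (n%:Z - 2)
  + 6 * n%:Z * (n%:Z - 1) * s%:Z * p%:Z ^+ 2 + 6 * n%:Z * s%:Z ^+ 2 * p%:Z.
Proof.
elim: n => [|n IHn].
  rewrite !weight_countS weight_count0n weight_count_row0n weight_count_rowSS //.
  by rewrite weight_count0n weight_count_row0n /= !muln0 !addn0; ring.
rewrite weight_countS PoszD mulrDr IHn.
have := weight_count_row3 n; set x := Posz (weight_count_row _ _) => e.
have -> : 6 * x = 3 * (2 * x) by ring.
by rewrite e -[n.+1]addn1 PoszD; ring.
Qed.

Lemma ball_size3 n (q := (#|F|)%:Z) : (2 <= n)%N ->
  6 * (ball_size F n 3)%:Z =
  (q - 1) ^+ 3 * n%:Z ^+ 3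
  + 3 * (q - 1) ^+ 2 * (2 * q ^+ 2 - q + 2) * n%:Z ^+ 2
  + (q - 1) * (6 * q ^+ 4 - 18 * q ^+ 3 + 26 * q ^+ 2 - 7 * q + 11) * n%:Z
  + 6 * (- 2 * q ^+ 5 + 4 * q ^+ 4 - 5 * q ^+ 3 + 3 * q ^+ 2 + 1).
Proof.
case: n => [|[|n]] // _.
have F0 : (0 < #|F|)%N by apply/card_gt0P; exists 0.
have pE : p%:Z = q - 1 by rewrite /p /q subzn.
have sE : s%:Z = q ^+ 2 + q - 1.
  by rewrite /s /q -Posz_expn -PoszD subzn // addn_gt0 F0 orbT.
rewrite ball_sizeE !big_ord_recr big_ord0 /= add0n.
rewrite weight_count_n0 weight_count1 3!PoszD PoszM 3!mulrDr weight_count3.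
have -> : 6 * (weight_count n.+2 2)%:Z = 3 * (2 * (weight_count n.+2 2)%:Z).
  by ring.
(* At size n + 2 the formula for weight 2 is used with n + 1, that for weight 3 with n. *)
rewrite weight_count2 pE sE -[n.+2]addn2 -[n.+1]addn1 !PoszD.
by ring.
Qed.

End FlagRank.

Theorem theorem5p14 (F : finFieldType) (q n alpha : nat)
    (C : {vspace 'M[F]_n})
    (hq : #|F| = q) (hn : (1 <= n)%N)
    (hC : flag_rank_code C)
    (hdelta : min_distance C = 7%N)
    (halpha : alpha = codimension C) :
  (perfect C <->
     (3 <= n)%N /\
     (q%:Z - 1) ^+ 3 * n%:Z ^+ 3
     + 3 * (q%:Z - 1) ^+ 2 * (2 * q%:Z ^+ 2 - q%:Z + 2) * n%:Z ^+ 2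
     + (q%:Z - 1) * (6 * q%:Z ^+ 4 - 18 * q%:Z ^+ 3 + 26 * q%:Z ^+ 2
                     - 7 * q%:Z + 11) * n%:Z
     + 6 * (- 2 * q%:Z ^+ 5 + 4 * q%:Z ^+ 4 - 5 * q%:Z ^+ 3 + 3 * q%:Z ^+ 2
            + 1 - q%:Z ^+ alpha) = 0 :> int)
  /\ (10 <= alpha)%N.
Proof.
have [n4 dimC] : (4 <= n)%N /\ (\dim C + 10 <= (n * n.+1) %/ 2)%N.
  by apply: dim_flag_rank_code; rewrite ?hdelta.
split; last by rewrite halpha /codimension; lia.
rewrite perfectE //; last by apply: leq_trans dimC; apply: leq_addr.
(* Once the term in q^alpha is split off, the polynomial is 6 times the ball size minus 6 q^alpha,
   so it vanishes exactly when the two agree. *)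
rewrite -halpha hq mulrBr addrA -hq -ball_size3; last exact: ltnW (ltnW n4).
rewrite -mulrBr -Posz_expn; split=> [->|[_ /eqP]].
  by rewrite subrr mulr0 ltnW.
by rewrite mulf_eq0 subr_eq0 /= => /eqP [].
Qed.
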